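(* Let $\{\mathbb{X}_n\}_{n\in\mathbb{N}}$ be a sequence of non-trivial normed linear spaces over $\mathbb{K}$. For $1<p<\infty$ and $x=\{x_n\}_{n\in\mathbb{N}},\,y=\{y_n\}_{n\in\mathbb{N}}\in\bigoplus_p\mathbb{X}_n$, $x\perp_By$ if and only if there exist semi-inner products $[\cdot,\cdot]_n$ on $\mathbb{X}_n$ ($n\in\mathbb{N}$) such that $$\sum_{n=1}^\infty\|x_n\|^{p-2}[x_n,y_n]_n=0,$$ where terms with $x_n=0$ are interpreted as $0$.
   Context: $\mathbb{K}=\mathbb{R}$ or $\mathbb{C}$; non-trivial means of dimension more than $0$. For $1\le p<\infty$, $\bigoplus_p\mathbb{X}_n$ is the space of sequences $\{x_n\}$ with $x_n\in\mathbb{X}_n$ and $\sum_n\|x_n\|^p<\infty$, with norm $\|\{x_n\}\|_p=(\sum_n\|x_n\|^p)^{1/p}$. In a normed space $\mathbb{X}$, $x\perp_By$ means $\|x+\lambda y\|\ge\|x\|$ for every scalar $\lambda\in\mathbb{K}$. A semi-inner product on a normed space $\mathbb{X}$ is a map $[\cdot,\cdot]:\mathbb{X}\times\mathbb{X}\to\mathbb{K}$ with, for $x,y,z\in\mathbb{X}$, $\lambda\in\mathbb{K}$: $[x,x]=\|x\|^2$; $[x,y]+\lambda[x,z]=[x,y+\lambda z]$; $[\lambda x,y]=\overline{\lambda}[x,y]$; $|[x,y]|^2\le[x,x][y,y]$. *)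

(* Defs.v *)
From HB Require Import structures.
From mathcomp Require Import all_boot all_order all_algebra.
From mathcomp Require Import complex.
From mathcomp Require Import all_classical all_reals all_analysis.

Set Implicit Arguments.
Unset Strict Implicit.
Unset Printing Implicit Defensive.

Import Order.TTheory GRing.Theory Num.Theory.
Import numFieldNormedType.Exports.

Local Open Scope classical_set_scope.
Local Open Scope ring_scope.

Variant scalar_kind := RealScalars | ComplexScalars.

Definition scalar_field (R : realType) (k : scalar_kind) : numFieldType :=
  match k with RealScalars => R | ComplexScalars => R[i]%C end.

Definition scalar_of_real (R : realType) (k : scalar_kind) : R -> scalar_field R k :=
  match k return R -> scalar_field R k with
  | RealScalars => id
  | ComplexScalars => real_complex R
  end.

Definition scalar_re (R : realType) (k : scalar_kind) : scalar_field R k -> R :=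
  match k return scalar_field R k -> R with
  | RealScalars => id
  | ComplexScalars => @complex.Re R
  end.

Definition scalar_conj (R : realType) (k : scalar_kind) :
    scalar_field R k -> scalar_field R k :=
  match k return scalar_field R k -> scalar_field R k with
  | RealScalars => id
  | ComplexScalars => @complex.conjc R
  end.

(* The norm of a [normedModType K] is K-valued; [rnorm] is the same norm as an
   element of R (see [scalar_of_rnorm]). *)
Definition rnorm (R : realType) (k : scalar_kind)
  (V : normedModType (scalar_field R k)) (v : V) : R := scalar_re `|v|.

Section scalar_theory.
Context (R : realType) (k : scalar_kind).
Local Notation K := (scalar_field R k).
Local Notation of_real := (@scalar_of_real R k).

Lemma scalar_of_realK (a : K) : 0 <= a -> of_real (scalar_re a) = a.
Proof.
case: k a => //= -[a b]; rewrite lecE/= => /andP[/eqP b0 _].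
by rewrite b0.
Qed.

Lemma scalar_of_realD a b : of_real (a + b) = of_real a + of_real b.
Proof. by case: k => //=; rewrite rmorphD. Qed.

Lemma scalar_of_realM a b : of_real (a * b) = of_real a * of_real b.
Proof. by case: k => //=; rewrite rmorphM. Qed.

Lemma ler_scalar_of_real a b : (of_real a <= of_real b) = (a <= b).
Proof. by case: k => //=; rewrite lecR. Qed.

Lemma scalar_of_real0 : of_real 0 = 0.
Proof. by case: k. Qed.

Lemma scalar_of_real_inj : injective of_real.
Proof. by move=> a b ab; apply/eqP; rewrite eq_le -!ler_scalar_of_real ab lexx. Qed.

Context (V : normedModType K).
Implicit Types u v : V.

Lemma scalar_of_rnorm v : of_real (rnorm v) = `|v|.
Proof. exact/scalar_of_realK/normr_ge0. Qed.

Lemma rnorm_ge0 v : 0 <= rnorm v.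
Proof. by rewrite -ler_scalar_of_real scalar_of_rnorm scalar_of_real0. Qed.

Lemma rnorm0 : rnorm (0 : V) = 0.
Proof.
by apply: scalar_of_real_inj; rewrite scalar_of_rnorm scalar_of_real0 normr0.
Qed.

Lemma rnorm0_eq0 v : rnorm v = 0 -> v = 0.
Proof.
by move=> v0; apply/eqP; rewrite -normr_eq0 -scalar_of_rnorm v0 scalar_of_real0.
Qed.

Lemma ler_rnormD u v : rnorm (u + v) <= rnorm u + rnorm v.
Proof.
by rewrite -ler_scalar_of_real scalar_of_realD !scalar_of_rnorm ler_normD.
Qed.

Lemma rnormN v : rnorm (- v) = rnorm v.
Proof. by rewrite /rnorm normrN. Qed.

Lemma rnormZ (l : K) v : rnorm (l *: v) = scalar_re `|l| * rnorm v.
Proof.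
apply: scalar_of_real_inj.
by rewrite scalar_of_realM !scalar_of_rnorm scalar_of_realK// normrZ.
Qed.

End scalar_theory.

Definition birkhoff_orthogonal (K : numDomainType) (V : normedModType K)
  (x y : V) : Prop := forall l : K, `|x| <= `|x + l *: y|.

Definition semi_inner_product (R : realType) (k : scalar_kind)
    (V : normedModType (scalar_field R k)) (s : V -> V -> scalar_field R k) : Prop :=
  [/\ forall x, s x x = `|x| ^+ 2,
      forall x y z (l : scalar_field R k), s x y + l * s x z = s x (y + l *: z),
      forall x y (l : scalar_field R k), s (l *: x) y = scalar_conj l * s x y &
      forall x y, `|s x y| ^+ 2 <= s x x * s y y].

(* The sum of nonnegative terms is taken in \bar R; [< +oo] is convergence. *)
Definition lp_summable (R : realType) (k : scalar_kind) (p : R)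
    (X : nat -> normedModType (scalar_field R k)) (x : forall n, X n) : Prop :=
  (\sum_(n <oo) (rnorm (x n) `^ p)%:E < +oo)%E.

(* [p1] is a parameter so that the normed space structure on [lp_sum p1 X],
   whose triangle inequality needs 1 <= p, can be inferred from the type. *)
Record lp_sum (R : realType) (k : scalar_kind) (p : R) (p1 : 1 <= p)
    (X : nat -> normedModType (scalar_field R k)) := LpSum {
  lp_seq :> forall n, X n;
  lp_seqP : lp_summable p lp_seq }.

Definition lp_norm (R : realType) (k : scalar_kind) (p : R) (p1 : 1 <= p)
    (X : nat -> normedModType (scalar_field R k)) (x : lp_sum p1 X) : R :=
  fine (\sum_(n <oo) (rnorm (x n) `^ p)%:E)%E `^ p^-1.

Section lp_real_sequences.
Context (R : realType) (p : R) (p1 : 1 <= p).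
Implicit Types u v w : nat -> R.

Let p0 : 0 < p. Proof. exact: lt_le_trans p1. Qed.

Let S u : \bar R := (\sum_(n <oo) (u n `^ p)%:E)%E.
Let N u : R := fine (S u) `^ p^-1.

Let S_ge0 u : (0 <= S u)%E.
Proof. by apply: nneseries_ge0 => n _ _; rewrite lee_fin powR_ge0. Qed.

Let S_fin u : (S u < +oo)%E -> S u \is a fin_num.
Proof. by move=> ?; rewrite ge0_fin_numE. Qed.

Let le_S u v : (forall n, 0 <= u n <= v n) -> (S u <= S v)%E.
Proof.
move=> uv; apply: lee_nneseries => [n _ _|n _]; rewrite lee_fin ?powR_ge0//.
have /andP[un0 unvn] := uv n.
by rewrite ge0_ler_powR ?(ltW p0)// nnegrE// (le_trans un0).
Qed.

Let Lnorm_S u : (forall n, 0 <= u n) ->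
  ('N[counting]_p%:E [EFin \o u] = S u `^ p^-1)%E.
Proof.
move=> u0; rewrite Lnorm_counting//; congr (_ `^ _)%E.
by apply: eq_eseriesr => n _ /=; rewrite ger0_norm// poweR_EFin.
Qed.

Let Lnorm_N u : (forall n, 0 <= u n) -> (S u < +oo)%E ->
  ('N[counting]_p%:E [EFin \o u] = (N u)%:E)%E.
Proof.
by move=> u0 Su; rewrite Lnorm_S// -[S u]fineK ?S_fin// poweR_EFin.
Qed.

Lemma lp_real_addP u v w : (forall n, 0 <= u n) -> (forall n, 0 <= v n) ->
  (forall n, 0 <= w n <= u n + v n) ->
  (\sum_(n <oo) (u n `^ p)%:E < +oo)%E ->
  (\sum_(n <oo) (v n `^ p)%:E < +oo)%E ->
  (\sum_(n <oo) (w n `^ p)%:E < +oo)%E /\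
  fine (\sum_(n <oo) (w n `^ p)%:E)%E `^ p^-1 <=
  fine (\sum_(n <oo) (u n `^ p)%:E)%E `^ p^-1 +
  fine (\sum_(n <oo) (v n `^ p)%:E)%E `^ p^-1.
Proof.
move=> u0 v0 wuv Su Sv.
have uv0 n : 0 <= (u \+ v) n by rewrite addr_ge0.
have := @minkowski_EFin _ _ R (@counting nat R) u v p (fun _ _ _ => I)
  (fun _ _ _ => I) p1.
rewrite [X in (_ <= X + _)%E](Lnorm_N u0 Su) [X in (_ <= _ + X)%E](Lnorm_N v0 Sv).
move=> mink.
have Suv : (S (u \+ v)%R < +oo)%E.
  rewrite ltey; apply/eqP => Suv; move: mink.
  by rewrite (Lnorm_S uv0) Suv poweRyr ?invr_eq0 ?gt_eqF// leye_eq.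
have Sw : (S w <= S (u \+ v)%R)%E by exact: le_S.
have Swy : (S w < +oo)%E by exact: le_lt_trans Suv.
split => //; move: mink; rewrite (Lnorm_N uv0 Suv) lee_fin; apply: le_trans.
have pV0 : 0 <= p^-1 by rewrite invr_ge0 ltW.
apply: (ge0_ler_powR pV0); rewrite ?nnegrE; [exact/fine_ge0/S_ge0..|].
exact: (fine_le (S_fin Swy) (S_fin Suv) Sw).
Qed.

Lemma lp_real_scaleP (c : R) u : 0 <= c -> (forall n, 0 <= u n) ->
  (\sum_(n <oo) (u n `^ p)%:E < +oo)%E ->
  (\sum_(n <oo) ((c * u n) `^ p)%:E < +oo)%E /\
  fine (\sum_(n <oo) ((c * u n) `^ p)%:E)%E `^ p^-1 =
  c * fine (\sum_(n <oo) (u n `^ p)%:E)%E `^ p^-1.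
Proof.
move=> c0 u0 Su.
have -> : (\sum_(n <oo) ((c * u n) `^ p)%:E = (c `^ p)%:E * S u)%E.
  rewrite -nneseriesZl; last by move=> n _; rewrite lee_fin powR_ge0.
  by apply: eq_eseriesr => n _; rewrite powRM// EFinM.
split; first by rewrite lte_mul_pinfty// lee_fin powR_ge0.
rewrite fineM ?S_fin//= powRM ?powR_ge0 ?fine_ge0//.
by rewrite -powRrM mulfV ?gt_eqF// powRr1.
Qed.

Lemma lp_real0 : (\sum_(n <oo) ((0 : R) `^ p)%:E = 0 :> \bar R)%E.
Proof. by apply: eseries0 => n _ _; rewrite powR0// gt_eqF. Qed.

Lemma lp_real_eq0 u : (forall n, 0 <= u n) ->
  (\sum_(n <oo) (u n `^ p)%:E < +oo)%E ->
  fine (\sum_(n <oo) (u n `^ p)%:E)%E `^ p^-1 = 0 -> forall n, u n = 0.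
Proof.
move=> u0 Su /powR_eq0_eq0 Su0 n; apply: (@powR_eq0_eq0 _ _ p).
have {}Su0 : S u = 0%E by rewrite -[S u]fineK ?S_fin// /S Su0.
apply/eqP; rewrite eq_le powR_ge0 andbT -lee_fin.
suff : ((u n `^ p)%:E <= S u)%E by rewrite Su0.
rewrite /S (@nneseriesD1 _ _ n)//=; last by move=> i _; rewrite lee_fin powR_ge0.
by rewrite leeDl// nneseries_ge0// => i _ _; rewrite lee_fin powR_ge0.
Qed.

End lp_real_sequences.

Section lp_sum_normed.
Context (R : realType) (k : scalar_kind) (p : R) (p1 : 1 <= p).
Context (X : nat -> normedModType (scalar_field R k)).
Local Notation K := (scalar_field R k).
Local Notation L := (lp_sum p1 X).
Implicit Types x y z : L.

Lemma lp_sum_eq x y : (forall n, x n = y n) -> x = y.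
Proof.
case: x y => [x hx] [y hy] /= xy.
have {}xy : x = y by apply: functional_extensionality_dep.
by subst y; congr LpSum; exact: Prop_irrelevance.
Qed.

Lemma lp_summable0 : lp_summable p (fun n => 0 : X n).
Proof.
rewrite /lp_summable; under eq_eseriesr do rewrite rnorm0.
by rewrite lp_real0.
Qed.

Lemma lp_summableN x : lp_summable p (fun n => - x n).
Proof.
rewrite /lp_summable; under eq_eseriesr do rewrite rnormN.
exact: lp_seqP.
Qed.

Lemma lp_summableD x y : lp_summable p (fun n => x n + y n).
Proof.
apply: (lp_real_addP p1 _ _ _ (lp_seqP x) (lp_seqP y)).1 => n;
  by rewrite ?rnorm_ge0 ?ler_rnormD.
Qed.

Lemma lp_summableZ (l : K) x : lp_summable p (fun n => l *: x n).
Proof.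
rewrite /lp_summable; under eq_eseriesr do rewrite rnormZ.
apply: (lp_real_scaleP p1 _ _ (lp_seqP x)).1 => [|n]; last exact: rnorm_ge0.
by rewrite (@rnorm_ge0 _ _ K^o).
Qed.

HB.instance Definition _ := gen_eqMixin L.
HB.instance Definition _ := gen_choiceMixin L.

Definition lp_zero : L := LpSum p1 lp_summable0.
Definition lp_opp x : L := LpSum p1 (lp_summableN x).
Definition lp_add x y : L := LpSum p1 (lp_summableD x y).
Definition lp_scale (l : K) x : L := LpSum p1 (lp_summableZ l x).

Lemma lp_addA : associative lp_add.
Proof. by move=> x y z; apply: lp_sum_eq => n; exact: addrA. Qed.
Lemma lp_addC : commutative lp_add.
Proof. by move=> x y; apply: lp_sum_eq => n; exact: addrC. Qed.
Lemma lp_add0 : left_id lp_zero lp_add.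
Proof. by move=> x; apply: lp_sum_eq => n; exact: add0r. Qed.
Lemma lp_addN : left_inverse lp_zero lp_opp lp_add.
Proof. by move=> x; apply: lp_sum_eq => n; exact: addNr. Qed.

HB.instance Definition _ :=
  GRing.isZmodule.Build L lp_addA lp_addC lp_add0 lp_addN.

Lemma lp_scaleA l m x : lp_scale l (lp_scale m x) = lp_scale (l * m) x.
Proof. by apply: lp_sum_eq => n; exact: scalerA. Qed.
Lemma lp_scale1 : left_id 1 lp_scale.
Proof. by move=> x; apply: lp_sum_eq => n; exact: scale1r. Qed.
Lemma lp_scaleDr : right_distributive lp_scale +%R.
Proof. by move=> l x y; apply: lp_sum_eq => n; exact: scalerDr. Qed.
Lemma lp_scaleDl x : {morph lp_scale^~ x : l m / l + m}.
Proof. by move=> l m; apply: lp_sum_eq => n; exact: scalerDl. Qed.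

HB.instance Definition _ := GRing.Zmodule_isLmodule.Build K L
  lp_scaleA lp_scale1 lp_scaleDr lp_scaleDl.

Lemma lp_normD x y : scalar_of_real k (lp_norm (x + y)) <=
  scalar_of_real k (lp_norm x) + scalar_of_real k (lp_norm y).
Proof.
rewrite -scalar_of_realD ler_scalar_of_real.
apply: (lp_real_addP p1 _ _ _ (lp_seqP x) (lp_seqP y)).2 => n;
  by rewrite ?rnorm_ge0 ?ler_rnormD.
Qed.

Lemma lp_normZ (l : K) x :
  scalar_of_real k (lp_norm (l *: x)) = `|l| * scalar_of_real k (lp_norm x).
Proof.
rewrite -[`|l|]scalar_of_realK// -scalar_of_realM; congr scalar_of_real.
rewrite /lp_norm /=; under eq_eseriesr do rewrite rnormZ.
apply: (lp_real_scaleP p1 _ _ (lp_seqP x)).2 => [|n]; last exact: rnorm_ge0.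
by rewrite (@rnorm_ge0 _ _ K^o).
Qed.

Lemma lp_norm_eq0 x : scalar_of_real k (lp_norm x) = 0 -> x = 0.
Proof.
rewrite -(scalar_of_real0 R k) => /scalar_of_real_inj x0.
apply: lp_sum_eq => n; apply: rnorm0_eq0.
exact: (lp_real_eq0 (fun m => rnorm_ge0 (x m)) (lp_seqP x) x0).
Qed.

HB.instance Definition _ := Lmodule_isNormed.Build K L
  lp_normD lp_normZ lp_norm_eq0.

Lemma lp_sumDE x y n : (x + y) n = x n + y n. Proof. by []. Qed.
Lemma lp_sumZE (l : K) x n : (l *: x) n = l *: x n. Proof. by []. Qed.
Lemma lp_sum_normE x : `|x| = scalar_of_real k (lp_norm x). Proof. by []. Qed.

End lp_sum_normed.

(* Main.v *)
(* If the series vanishes, then p Re (l T_n) <= |x_n + l y_n|^p - |x_n|^p for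
   each of its terms T_n: this is Young's inequality
   p |x_n|^(p-1) b <= (p-1) |x_n|^p + b^p combined with
   |[x_n, x_n + l y_n]| <= |x_n| |x_n + l y_n|. Summing gives |x| <= |x + l y|.

   Conversely, Hahn-Banach provides a norm-one functional F with F x = |x| and
   F y = 0. Comparing F (x + v) with |x + v| for v supported on the n-th
   coordinate, and letting v tend to 0, the differentiability of t |-> t^p shows
   that |x|^(p-1) F restricts on X_n to |x_n|^(p-2) [x_n, -] for a functional
   [x_n, -] of norm |x_n| with [x_n, x_n] = |x_n|^2. Such a functional extends to
   a semi-inner product on X_n by choosing norming functionals for one
   representative of each line, and F y = 0 is the sum of the restrictions of F
   to the coordinates of y. *)

Require Import Defs.
From HB Require Import structures.
From mathcomp Require Import all_boot all_order all_algebra.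
From mathcomp Require Import complex ring lra.
From mathcomp Require Import all_classical all_reals all_analysis.

Set Implicit Arguments.
Unset Strict Implicit.
Unset Printing Implicit Defensive.

Import Order.TTheory GRing.Theory Num.Theory.
Import numFieldNormedType.Exports.

Local Open Scope classical_set_scope.
Local Open Scope ring_scope.

(** * Real parts, conjugation and phases, for both scalar fields at once *)

Section scalars.
Context (R : realType) (k : scalar_kind).
Local Notation K := (scalar_field R k).
Local Notation of_real := (@scalar_of_real R k).
Local Notation re := (@scalar_re R k).

Lemma scalar_of_real1 : of_real 1 = 1.
Proof. by case: k. Qed.

Lemma scalar_of_realN a : of_real (- a) = - of_real a.
Proof. by case: k => //=; rewrite rmorphN. Qed.

Lemma scalar_of_realX a n : of_real (a ^+ n) = of_real a ^+ n.
Proof. by case: k => //=; rewrite rmorphXn. Qed.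

Lemma scalar_reK a : re (of_real a) = a.
Proof. by case: k. Qed.

Lemma scalar_re0 : re 0 = 0.
Proof. by case: k. Qed.

Lemma scalar_reD (a b : K) : re (a + b) = re a + re b.
Proof. by case: k a b => //= -[a b] [c d]. Qed.

Lemma scalar_reZ r (a : K) : re (of_real r * a) = r * re a.
Proof. by case: k a => //= -[a b] /=; rewrite mul0r subr0. Qed.

Lemma scalar_re_sum (u : nat -> K) n :
  re (\sum_(0 <= i < n) u i) = \sum_(0 <= i < n) re (u i).
Proof.
by elim/big_ind2 : _ => [|a b c d <- <-|]; rewrite ?scalar_re0 ?scalar_reD.
Qed.

Lemma ler_scalar_re_norm (a : K) : `|re a| <= re `|a|.
Proof.
case: k a => //= -[a b]; rewrite -lecR.
have -> : (complex.Re `|(a +i* b)%C|)%:C%C = `|(a +i* b)%C| by rewrite normc_def.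
by have /= := normc_ge_Re (a +i* b)%C; rewrite normc_def /=.
Qed.

Lemma scalar_norm_of_real r : 0 <= r -> `|of_real r| = of_real r.
Proof.
by move=> r0; rewrite ger0_norm// -(scalar_of_real0 R k) ler_scalar_of_real.
Qed.

Lemma ltr_scalar_of_real a b : (of_real a < of_real b) = (a < b).
Proof.
by rewrite !lt_neqAle ler_scalar_of_real (inj_eq (@scalar_of_real_inj R k)).
Qed.

Lemma ler_scalar_re (a b : K) : 0 <= a -> 0 <= b -> (a <= b) = (re a <= re b).
Proof. by move=> a0 b0; rewrite -(ler_scalar_of_real k) !scalar_of_realK. Qed.

Lemma scalar_mul_conj (a : K) : scalar_conj a * a = `|a| ^+ 2.
Proof.
case: k a => /= a; first by rewrite real_normK ?num_real// expr2.
by rewrite mulrC; apply: esym; exact: normCK.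
Qed.

Lemma scalar_conj1 : scalar_conj 1 = 1 :> K.
Proof. by case: k => //=; exact: conjc1. Qed.

Lemma scalar_conj0 : scalar_conj 0 = 0 :> K.
Proof. by case: k => //=; exact: conjc0. Qed.

Lemma scalar_conjM (a b : K) :
  scalar_conj (a * b) = scalar_conj a * scalar_conj b.
Proof. by case: k a b => //= a b; exact: rmorphM. Qed.

Lemma scalar_norm_conj (a : K) : `|scalar_conj a| = `|a|.
Proof. by case: k a => //= a; exact: norm_conjC. Qed.

(** Rotating by [t] turns a bound on the real part of a linear functional into a bound on its
    modulus. *)
Lemma scalar_phase (a : K) : exists2 t : K, `|t| = 1 & t * a = `|a|.
Proof.
have [->|a0] := eqVneq a 0; first by exists 1; rewrite ?normr1// mulr0 normr0.
exists (`|a| / a); last by rewrite mulfVK.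
by rewrite normrM normr_id normrV ?unitfE// divff// normr_eq0.
Qed.

End scalars.

(** * The Hahn-Banach theorem in Mazur-Orlicz form *)

Section mazur_orlicz.
Context (R : realType) (k : scalar_kind) (V : lmodType (scalar_field R k)).
Local Notation of_real := (@scalar_of_real R k).
Implicit Types (q u : V -> R) (C : set (V * R)) (v w : V).

Definition sublinear q :=
  (forall v w, q (v + w) <= q v + q w) /\
  (forall a v, 0 <= a -> q (of_real a *: v) <= a * q v).

(** A convex cone of demands: a pair [(v, a)] in [C] asks a functional to be at least [a] at [v],
    and the last clause makes each demand compatible with [q]. *)
Definition dominated_cone q C :=
  [/\ C (0, 0), forall v w a b, C (v, a) -> C (w, b) -> C (v + w, a + b),
      forall t v a, 0 <= t -> C (v, a) -> C (of_real t *: v, t * a) &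
      forall v a, C (v, a) -> a <= q v].

(* A linear functional below [cone_inf q C] is at most [q], and is at least [a]
   at [w] for every [(w, a)] in [C] (evaluate at [- w]). *)
Definition cone_inf q C v := inf [set q (v + w.1) - w.2 | w in C].

Lemma sublinear0 q : sublinear q -> q 0 = 0.
Proof.
move=> [qD qZ]; apply/eqP; rewrite eq_le.
have := qZ 0 0 (lexx _); rewrite scalar_of_real0 scale0r mul0r => ->/=.
by have := qD 0 0; rewrite addr0; lra.
Qed.

Section cone_inf.
Variables (q : V -> R) (C : set (V * R)).
Hypotheses (q_sub : sublinear q) (C_cone : dominated_cone q C).

Lemma cone_inf_le v w a : C (w, a) -> cone_inf q C v <= q (v + w) - a.
Proof.
move=> Cwa; apply: ge_inf; last by exists (w, a).
exists (- q (- v)) => _ [[w' a'] /= Cw <-].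
have [_ _ _ /(_ _ _ Cw)] := C_cone.
by have := q_sub.1 (v + w') (- v); rewrite addrAC subrr add0r; lra.
Qed.

Lemma le_cone_inf v m :
  (forall w a, C (w, a) -> m <= q (v + w) - a) -> m <= cone_inf q C v.
Proof.
move=> mq; apply: lb_le_inf; last by move=> _ [[w a] /= Cw <-]; exact: mq.
by exists (q (v + 0) - 0), (0, 0) => //; have [] := C_cone.
Qed.

(** Sums and multiples of members of [C] are competitors for the infimum at [v + w] and at [t v].
    For [t > 0] the resulting bound is divided by [t]; at [t = 0] the member [(0, 0)] settles it. *)
Lemma sublinear_cone_inf : sublinear (cone_inf q C).
Proof.
have [C0 CD CZ Cq] := C_cone; have [qD qZ] := q_sub; split=> [v w|t v t0].
  rewrite -lerBlDr; apply: le_cone_inf => w1 a1 C1; rewrite lerBlDr -lerBlDl.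
  apply: le_cone_inf => w2 a2 C2; rewrite lerBlDl.
  apply: le_trans (cone_inf_le _ (CD _ _ _ _ C1 C2)) _.
  have := qD (v + w1) (w + w2); rewrite addrACA; lra.
have le w a : C (w, a) -> cone_inf q C (of_real t *: v) <= t * (q (v + w) - a).
  move=> Cw; apply: le_trans (cone_inf_le _ (CZ _ _ _ t0 Cw)) _.
  by have := qZ t (v + w) t0; rewrite scalerDr mulrBr; lra.
have [t_eq0|t_neq0] := eqVneq t 0.
  by have := le _ _ C0; rewrite t_eq0 !mul0r.
have {t_neq0}t0' : 0 < t by rewrite lt0r t_neq0.
rewrite mulrC -ler_pdivrMr//; apply: le_cone_inf => w a Cw.
by rewrite ler_pdivrMr// mulrC le.
Qed.

Lemma cone_inf_id v : cone_inf q C v <= q v.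
Proof.
have [C0 _ _ _] := C_cone.
by have := cone_inf_le v C0; rewrite addr0 subr0.
Qed.

End cone_inf.

(** The ray through [(w, q w)]. Homogeneity of [q] is only an inequality; applied with [t^-1] it
    gives the reverse one, which is domination. *)
Lemma dominated_cone_ray q w : sublinear q ->
  dominated_cone q [set z | exists2 t, 0 <= t & z = (of_real t *: w, t * q w)].
Proof.
move=> [qD qZ]; split=> [||t v a t0|v a].
- by exists 0; rewrite // scalar_of_real0 scale0r mul0r.
- move=> _ _ _ _ [t t0 [-> ->]] [s s0 [-> ->]]; exists (t + s).
    by rewrite addr_ge0.
  by rewrite scalar_of_realD scalerDl mulrDl.
- move=> [s s0 [-> ->]]; exists (t * s); first by rewrite mulr_ge0.
  by rewrite scalar_of_realM scalerA mulrA.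
move=> [t t0 [-> ->]]; have [->|t_neq0] := eqVneq t 0.
  by rewrite mul0r scalar_of_real0 scale0r sublinear0.
have := qZ t^-1 (of_real t *: w); rewrite invr_ge0 => /(_ t0).
rewrite scalerA -scalar_of_realM mulVf// scalar_of_real1 scale1r.
by rewrite -ler_pdivlMl ?invr_gt0 ?lt0r ?t_neq0// invrK.
Qed.

Definition real_linear u :=
  {morph u : v w / v + w} /\ (forall a v, u (of_real a *: v) = a * u v).

Lemma minimal_sublinear_linear q : sublinear q ->
  (forall q', sublinear q' -> (forall v, q' v <= q v) -> q' = q) ->
  real_linear q.
Proof.
move=> q_sub q_min; have [qD qZ] := q_sub.
have addq v w : q (v + w) = q v + q w.
  apply/eqP; rewrite eq_le qD/=.
  have C_cone := dominated_cone_ray w q_sub.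
  (* By minimality [cone_inf] along the ray of [w] is [q] itself, so that
     [q v <= q (v + w) - q w]. *)
  have := q_min _ (sublinear_cone_inf q_sub C_cone) (cone_inf_id q_sub C_cone).
  move=> /(congr1 (fun f => f v)) <-; rewrite -lerBrDr.
  apply: cone_inf_le => //; exists 1 => //.
  by rewrite scalar_of_real1 scale1r mul1r.
have oppq v : q (- v) = - q v.
  by apply/eqP; rewrite -addr_eq0 -addq addNr sublinear0.
(* Oddness turns the homogeneity inequality at [- v] into the reverse one at [v]. *)
have scaleq a v : 0 <= a -> q (of_real a *: v) = a * q v.
  move=> a0; apply/eqP; rewrite eq_le qZ//=.
  by have := qZ a (- v) a0; rewrite scalerN !oppq mulrN lerN2.
split=> [//|a v]; have [a0|a0] := leP 0 a; first exact: scaleq.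
rewrite -[a]opprK scalar_of_realN scaleNr oppq scaleq ?mulNr//.
by rewrite oppr_ge0 ltW.
Qed.

(** Zorn's lemma: the pointwise infimum of a chain is again sublinear, and it is a real number
    because every member stays above [- q (- v)]. *)
Lemma minimal_sublinear q : sublinear q ->
  exists u, [/\ sublinear u, forall v, u v <= q v &
    forall q', sublinear q' -> (forall v, q' v <= u v) -> q' = u].
Proof.
move=> q_sub; pose T := {u | sublinear u /\ forall v, u v <= q v}.
(* The order is reversed, so that a maximal element is a pointwise minimal functional. *)
pose le (s t : T) := `[< forall v, sval t v <= sval s v >].
have leP s t : reflect (forall v, sval t v <= sval s v) (le s t) by exact: asboolP.
have sval_eq (s t : T) : sval s = sval t -> s = t.
  case: s t => s s_T [t t_T] /= st; subst t.
  by congr exist; exact: Prop_irrelevance.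
have lb (s : T) v : - q (- v) <= sval s v.
  case: s => /= s [s_sub sq]; have := s_sub.1 v (- v).
  by rewrite subrr (sublinear0 s_sub); have := sq (- v); lra.
have [|||A A_tot|[u [u_sub uq]] u_max] := @Zorn T le.
- by move=> t; apply/leP.
- by move=> r s t /leP rs /leP st; apply/leP => v; exact: le_trans (rs v).
- move=> s t /leP st /leP ts; apply: sval_eq; apply/funext => v.
  by apply/eqP; rewrite eq_le st ts.
(* The empty chain is bounded by [q] itself. *)
- have [[s0 As0]|A0] := pselect (exists s, A s); last first.
    have q_T : sublinear q /\ forall v, q v <= q v by [].
    by exists (exist _ q q_T) => s As; case: A0; exists s.
  pose E v := [set sval s v | s in A]; pose m v := inf (E v).
  have E0 v : E v !=set0 by exists (sval s0 v), s0.
  have m_le s v : A s -> m v <= sval s v.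
    move=> As; apply: ge_inf; last by exists s.
    by exists (- q (- v)) => _ [t _ <-].
  have le_m v c : (forall s, A s -> c <= sval s v) -> c <= m v.
    by move=> cs; apply: lb_le_inf => // _ [s As <-]; exact: cs.
  have m_sub : sublinear m.
    split=> [v w|a v a0].
      rewrite -lerBlDr; apply: (le_m) => s As; rewrite lerBlDr -lerBlDl.
      apply: (le_m) => t At; rewrite lerBlDl.
      (* Within a chain, the lower of [s] and [t] can be used at both [v] and [w]. *)
      have [st|ts] : le s t \/ le t s by exact: A_tot.
        have/leP/(_ v) := st; have := (svalP t).1.1 v w.
        by have := m_le t (v + w) At; lra.
      have/leP/(_ w) := ts; have := (svalP s).1.1 v w.
      by have := m_le s (v + w) As; lra.
    have mZ s : A s -> m (of_real a *: v) <= a * sval s v.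
      by move=> As; apply: le_trans (m_le s _ As) ((svalP s).1.2 _ _ a0).
    have [a_eq0|a_neq0] := eqVneq a 0.
      by have := mZ _ As0; rewrite a_eq0 !mul0r.
    have {a_neq0}a0' : 0 < a by rewrite lt0r a_neq0.
    rewrite mulrC -ler_pdivrMr//; apply: (le_m) => s As.
    by rewrite ler_pdivrMr// mulrC mZ.
  have m_T : sublinear m /\ forall v, m v <= q v.
    by split=> // v; apply: le_trans (m_le _ _ As0) ((svalP s0).2 v).
  by exists (exist _ m m_T) => s As; apply/leP => v; exact: m_le.
exists u; split=> // q' q'_sub q'u.
have q'_T : sublinear q' /\ forall v, q' v <= q v.
  by split=> // v; exact: le_trans (uq v).
by apply: (congr1 sval (u_max (exist _ q' q'_T) _)); exact/leP.
Qed.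

(** Take a minimal sublinear functional below [cone_inf q C]: minimality makes it linear, and
    [cone_inf] encodes both bounds. *)
Theorem mazur_orlicz q C : sublinear q -> dominated_cone q C ->
  exists u, [/\ real_linear u, forall v, u v <= q v &
    forall v a, C (v, a) -> a <= u v].
Proof.
move=> q_sub C_cone.
have [u [u_sub u_le u_min]] :=
  minimal_sublinear (sublinear_cone_inf q_sub C_cone).
have u_lin := minimal_sublinear_linear u_sub u_min.
exists u; split=> // [v|v a Cv].
  exact: le_trans (u_le v) (cone_inf_id q_sub C_cone v).
have := le_trans (u_le (- v)) (cone_inf_le q_sub C_cone (- v) Cv).
rewrite addNr (sublinear0 q_sub) sub0r.
by rewrite -scaleN1r -(scalar_of_real1 R k) -scalar_of_realN u_lin.2 mulN1r lerN2.
Qed.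

End mazur_orlicz.

(** * Scalar-linear functionals and their real parts *)

Section scalar_linear.
Context (R : realType) (k : scalar_kind) (V : lmodType (scalar_field R k)).
Local Notation K := (scalar_field R k).
Local Notation re := (@scalar_re R k).

(** Same shape as the linearity clause of [semi_inner_product], so that a row [s x] satisfies it
    verbatim. *)
Definition scalar_linear (f : V -> K) :=
  forall (v w : V) (l : K), f v + l * f w = f (v + l *: w).

Lemma scalar_linear0 (f : V -> K) : scalar_linear f -> f 0 = 0.
Proof.
move=> f_lin; have := f_lin 0 0 1; rewrite mul1r scale1r addr0.
by move/(canRL (addrK _)); rewrite subrr.
Qed.

Lemma scalar_linearZ (f : V -> K) (l : K) (w : V) :
  scalar_linear f -> f (l *: w) = l * f w.
Proof.
by move=> f_lin; rewrite -[l *: _]add0r -f_lin scalar_linear0// add0r.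
Qed.

Lemma scalar_linear_sum (F : V -> K) (v : nat -> V) N :
  scalar_linear F ->
  F (\sum_(0 <= n < N) v n) = \sum_(0 <= n < N) F (v n).
Proof.
move=> F_lin; elim: N => [|N IH]; first by rewrite !big_geq// scalar_linear0.
by rewrite !big_nat_recr//= -IH -[F (v N)]mul1r F_lin scale1r.
Qed.

Lemma scalar_linearB (F : V -> K) (v w : V) :
  scalar_linear F -> F (v - w) = F v - F w.
Proof. by move=> F_lin; rewrite -scaleN1r -F_lin mulN1r. Qed.

(** In the complex case, [u] is the real part of [u v - i u (i v)]. *)
Lemma scalar_linear_re (u : V -> R) : real_linear u ->
  exists2 f : V -> K, scalar_linear f & forall v, re (f v) = u v.
Proof.
move=> [uD uZ]; rewrite /scalar_linear; case: k V u uD uZ => /= W u uD uZ.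
  by exists u => // v w l; rewrite uD uZ.
pose i : R[i]%C := ('i)%C.
exists (fun v => (u v +i* - u (i *: v))%C) => // v w [a b].
have -> : (a +i* b)%C = a%:C%C + i * b%:C%C.
  by apply/eqP; rewrite eq_complex /=; apply/andP; split; apply/eqP; ring.
have bE : u (b%:C%C *: w) = b * u w := uZ b w.
have aE : u (a%:C%C *: w) = a * u w := uZ a w.
have biE : u (b%:C%C *: (i *: w)) = b * u (i *: w) := uZ b _.
have aiE : u (a%:C%C *: (i *: w)) = a * u (i *: w) := uZ a _.
have i2 z : u (i *: (i *: z)) = - u z.
  have := uZ (-1) z; rewrite mulN1r /= => <-; rewrite scalerA; congr (u (_ *: _)).
  by apply/eqP; rewrite eq_complex /=; apply/andP; split; apply/eqP; ring.
have iE : u ((i * b%:C%C) *: w) = b * u (i *: w).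
  by rewrite mulrC -scalerA.
rewrite !scalerDr !scalerDl !uD iE aE.
rewrite scalerDr uD [i *: (a%:C%C *: w)]scalerA [i * a%:C%C]mulrC -scalerA aiE.
rewrite -scalerA i2 bE.
by apply/eqP; rewrite eq_complex /=; apply/andP; split; apply/eqP; ring.
Qed.

End scalar_linear.

(** * Norming functionals and Birkhoff orthogonality *)

Section support_functionals.
Context (R : realType) (k : scalar_kind) (V : normedModType (scalar_field R k)).
Local Notation K := (scalar_field R k).
Local Notation of_real := (@scalar_of_real R k).
Local Notation re := (@scalar_re R k).
Implicit Types v w x y : V.

(** Evaluate the bound at [t v], where the phase [t] makes [f (t v) = |f v|]. *)
Lemma scalar_norm_le (f : V -> K) (c : R) v : scalar_linear f ->
  (forall w, re (f w) <= c * rnorm w) -> `|f v| <= of_real c * `|v|.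
Proof.
move=> f_lin f_le; have [t t1 tf] := scalar_phase (f v).
rewrite -[`|f v|]scalar_of_realK// -[`|v|]scalar_of_rnorm -scalar_of_realM.
rewrite ler_scalar_of_real -tf -scalar_linearZ//.
have := f_le (t *: v).
by rewrite rnormZ t1 -(scalar_of_real1 R k) scalar_reK mul1r.
Qed.

(** Squaring leaves no room for an imaginary part. This upgrades identities of real parts to
    identities of scalars. *)
Lemma scalar_norm_eq (a : K) : `|a| <= of_real (re a) -> a = of_real (re a).
Proof.
case: k a => //= -[a b]; rewrite normc_def/= lecR => ab.
have a0 : 0 <= a := le_trans (sqrtr_ge0 _) ab.
have : a ^+ 2 + b ^+ 2 <= a ^+ 2.
  by rewrite -ler_sqrt ?sqr_ge0// sqrtr_sqr ger0_norm.
rewrite gerDl => b0; suff -> : b = 0 by [].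
by apply/eqP; rewrite -sqrf_eq0 eq_le b0 sqr_ge0.
Qed.

Lemma sublinear_rnorm : sublinear (@rnorm R k V).
Proof.
split=> [v w|a v a0]; first exact: ler_rnormD.
by rewrite rnormZ scalar_norm_of_real// scalar_reK.
Qed.

Lemma birkhoff_functional x y : birkhoff_orthogonal x y ->
  exists f : V -> K, [/\ scalar_linear f, forall v, `|f v| <= `|v|,
    f x = `|x| & f y = 0].
Proof.
move=> xy.
(* The cone forces [f x = `|x|]; it contains the whole line of [y] at height 0,
   which forces [f y = 0]. *)
pose C := [set z : V * R | exists t (l : K),
  0 <= t /\ z = (of_real t *: x + l *: y, t * rnorm x)].
have C_cone : dominated_cone (@rnorm R k V) C.
  split=> [||t v a t0|v a].
  - by exists 0, 0; split=> //; rewrite scalar_of_real0 !scale0r mul0r addr0.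
  - move=> _ _ _ _ [t [l [t0 [-> ->]]]] [s [m [s0 [-> ->]]]].
    exists (t + s), (l + m); split; first by rewrite addr_ge0.
    by rewrite scalar_of_realD !scalerDl mulrDl addrACA.
  - move=> [s [l [s0 [-> ->]]]]; exists (t * s), (of_real t * l).
    by rewrite mulr_ge0// scalerDr !scalerA scalar_of_realM mulrA.
  (* For [t > 0], factoring out [t] reduces domination to orthogonality with the scalar [t^-1 l]. *)
  move=> [t [l [t0 [-> ->]]]]; have [->|t_neq0] := eqVneq t 0.
    by rewrite mul0r rnorm_ge0.
  have t_neq0' : of_real t != 0.
    apply: contra_neq t_neq0 => t_eq0; apply: (@scalar_of_real_inj _ k).
    by rewrite t_eq0 scalar_of_real0.
  have -> : of_real t *: x + l *: y =
      of_real t *: (x + ((of_real t)^-1 * l) *: y).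
    by rewrite scalerDr scalerA mulrA mulfV// mul1r.
  rewrite rnormZ scalar_norm_of_real// scalar_reK ler_wpM2l//.
  by rewrite -(ler_scalar_of_real k) !scalar_of_rnorm; exact: xy.
have [u [u_lin u_le u_ge]] := mazur_orlicz sublinear_rnorm C_cone.
have [f f_lin fu] := scalar_linear_re u_lin.
have f_le v : `|f v| <= `|v|.
  rewrite -[leRHS]mul1r -(scalar_of_real1 R k); apply: scalar_norm_le => // w.
  by rewrite fu mul1r.
exists f; split=> //.
  have re_fx : re (f x) = rnorm x.
    apply/eqP; rewrite eq_le fu u_le/=; apply: u_ge.
    exists 1, 0; split=> //.
    by rewrite scalar_of_real1 scale1r scale0r addr0 mul1r.
  by rewrite (@scalar_norm_eq (f x)) re_fx scalar_of_rnorm.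
(* With [t] the phase of [f y], the point [- t y] of the cone gives [- |f y| >= 0]. *)
have [t t1 tf] := scalar_phase (f y).
have : re (f (- t *: y)) >= 0.
  rewrite fu; apply: u_ge; exists 0, (- t); split=> //.
  by rewrite scalar_of_real0 scale0r add0r mul0r.
rewrite scalar_linearZ// mulNr tf -mulN1r -(scalar_of_real1 R k).
rewrite -scalar_of_realN scalar_reZ mulN1r oppr_ge0 => re_le0.
by apply/eqP; rewrite -normr_le0 ler_scalar_re// scalar_re0.
Qed.

End support_functionals.

(** * Extending one functional to a semi-inner product *)

Section semi_inner_product_extension.
Context (R : realType) (k : scalar_kind) (V : normedModType (scalar_field R k)).
Local Notation K := (scalar_field R k).
Implicit Types (v w x y : V) (f : V -> K).

(** The possible rows [s x] of a semi-inner product: [|x|] times a norming functional of [x]. *)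
Definition sip_functional x f :=
  [/\ scalar_linear f, forall v, `|f v| <= `|x| * `|v| & f x = `|x| ^+ 2].

(** Every [x] is orthogonal to 0, which yields a norming functional to be scaled by [|x|]. *)
Lemma sip_functional_exists x : exists f, sip_functional x f.
Proof.
have [|f [f_lin f_le fx _]] := @birkhoff_functional R k V x 0.
  by move=> l; rewrite scaler0 addr0.
exists (fun v => `|x| * f v); split=> [v w l|v|].
- by rewrite -f_lin mulrDr mulrCA.
- by rewrite normrM normr_id ler_wpM2l.
by rewrite fx expr2.
Qed.

(** Excluding the zero multiple makes these sets the classes of an equivalence relation. *)
Let line x := [set y | exists2 l : K, l != 0 & y = l *: x].

Let line_scale x (l : K) : l != 0 -> line (l *: x) = line x.
Proof.
move=> l0; apply/seteqP; split=> [_ [m m0 ->]|_ [m m0 ->]].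
  by exists (m * l); rewrite ?mulf_neq0// scalerA.
by exists (m / l); rewrite ?mulf_neq0 ?invr_eq0// scalerA divfK.
Qed.

(** Choose one representative per line and write [y = c y *: rep y]. The row at [y] is the conjugate
    of [c y] times a row chosen at [rep y]. *)
Lemma semi_inner_product_extend x f : sip_functional x f ->
  exists2 s, semi_inner_product s & forall v, s x v = f v.
Proof.
move=> f_sip.
(* [x] itself represents its line, so that [f] is not changed. *)
pose rep y := if `[< line y x >] then x else xget 0 (line y).
(* The default 0 of [xget] is never reached, since [y] lies on its own line. *)
have repP y : line y (rep y).
  rewrite /rep; case: asboolP => // _; apply: xgetPex.
  by exists y, 1; rewrite ?oner_neq0 ?scale1r.
have rep_scale (l : K) y : l != 0 -> rep (l *: y) = rep y.
  by move=> l0; rewrite /rep line_scale.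
have [c cP] : {c : V -> K & forall y, y = c y *: rep y}.
  apply: (@choice _ _ (fun y l => y = l *: rep y)) => y.
  by have [l l0 ->] := repP y; exists l^-1; rewrite scalerA mulVf// scale1r.
have repx : rep x = x.
  by rewrite /rep asboolT//; exists 1; rewrite ?oner_neq0 ?scale1r.
have [g [g_sip gx]] :
    {g : V -> V -> K | (forall y, sip_functional y (g y)) /\ g x = f}.
  have [g g_sip] := choice sip_functional_exists.
  exists (fun y => if y == x then f else g y); rewrite eqxx; split=> // y.
  by case: eqP => // ->.
(* [c] comes from bare choice; its uniqueness away from 0 makes it homogeneous there. *)
have c_unique (l : K) y : y != 0 -> y = l *: rep y -> c y = l.
  move=> y0 yl; apply/eqP; rewrite -subr_eq0.
  have : (c y - l) *: rep y == 0 by rewrite scalerBl -cP -yl subrr.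
  rewrite scaler_eq0 => /orP[//|/eqP r0].
  by move: y0; rewrite yl r0 scaler0 eqxx.
have normE y : `|y| = `|c y| * `|rep y| by rewrite {1}[y]cP normrZ.
have norm_le y v : `|scalar_conj (c y) * g (rep y) v| <= `|y| * `|v|.
  have [_ g_le _] := g_sip (rep y).
  by rewrite normrM scalar_norm_conj (normE y) -mulrA ler_wpM2l.
(* The value [c 0] is arbitrary, but the norm bound kills the row at 0. *)
have sip0 v : scalar_conj (c 0) * g (rep 0) v = 0.
  by apply/eqP; rewrite -normr_le0 (le_trans (norm_le _ _))// normr0 mul0r.
have sip_norm y : scalar_conj (c y) * g (rep y) y = `|y| ^+ 2.
  have [g_lin _ gy] := g_sip (rep y).
  rewrite {3}[y]cP scalar_linearZ// gy mulrA scalar_mul_conj -exprMn.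
  by rewrite -normE.
exists (fun y v => scalar_conj (c y) * g (rep y) v); last first.
  move=> v; have [x0|x0] := eqVneq x 0.
    rewrite x0 sip0; apply/esym/eqP; rewrite -normr_le0.
    by have [_ /(_ v) f_le _] := f_sip; rewrite (le_trans f_le)// x0 normr0 mul0r.
  by rewrite (c_unique 1)// repx ?scale1r// scalar_conj1 mul1r gx.
split=> [//|y v w l|y v l|y v].
- by have [<- _ _] := g_sip (rep y); rewrite mulrDr mulrCA.
- have [->|l0] := eqVneq l 0; first by rewrite scale0r sip0 scalar_conj0 mul0r.
  have [->|y0] := eqVneq y 0; first by rewrite scaler0 sip0 mulr0.
  rewrite (c_unique (l * c y)) ?scaler_eq0 ?negb_or ?l0//.
    by rewrite rep_scale// scalar_conjM mulrA.
  by rewrite rep_scale// -scalerA -cP.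
by rewrite !sip_norm -exprMn lerXn2r ?nnegrE// mulr_ge0.
Qed.

End semi_inner_product_extension.

(** * Inequalities and one-sided limits for real powers *)

Section powR_facts.
Context (R : realType).
Implicit Types a b c m p s t : R.

Lemma powRD_gt0 a s t : 0 < a -> a `^ s * a `^ t = a `^ (s + t).
Proof. by move=> a0; rewrite powRD// (gt_eqF a0) implybT. Qed.

(** Young's inequality for [a^(p-1)] and [b], with conjugate exponents [p / (p - 1)] and [p]. *)
Lemma young_powR p a b : 1 < p -> 0 <= a -> 0 <= b ->
  p * (a `^ (p - 1) * b) <= (p - 1) * a `^ p + b `^ p.
Proof.
move=> p1 a0 b0; have p0 : 0 < p by lra.
have q0 : 0 < p - 1 by lra.
have := @conjugate_powR R (a `^ (p - 1)) b (p / (p - 1)) p (powR_ge0 _ _) b0.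
rewrite divr_gt0// p0 -powRrM mulrCA mulfV ?gt_eqF// mulr1.
have -> : (p / (p - 1))^-1 + p^-1 = 1 by field; rewrite !gt_eqF.
move=> /(_ isT isT erefl); rewrite -(ler_pM2l p0) => /le_trans; apply.
by rewrite le_eqVlt; apply/orP; left; apply/eqP; field; rewrite !gt_eqF.
Qed.

(** Convexity: the graph of the [p]-th power lies above its tangent at [c]. *)
Lemma powR_tangent p a c : 1 < p -> 0 <= a -> 0 <= c ->
  c `^ p - a `^ p <= p * (c `^ (p - 1) * (c - a)).
Proof.
move=> p1 a0 c0; have := young_powR p1 c0 a0.
have <- : c `^ (p - 1) * c = c `^ p by rewrite mulrC mulr_powRB1//; lra.
by lra.
Qed.

Lemma continuous_powR s a : 0 < a -> {for a, continuous (fun x => x `^ s)}.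
Proof.
move=> a0; apply: differentiable_continuous; apply/derivable1_diffP.
by apply: derivable_powR; rewrite in_itv/= a0.
Qed.

(** Let [c] decrease to [a]; the power converges by [s > 0] when [a = 0], and by continuity when
    [a > 0]. *)
Lemma powR_right_le s a b m : 0 <= a -> 0 < s ->
  (forall c, a < c -> m <= c `^ s * b) -> m <= a `^ s * b.
Proof.
move=> a0 s0 m_le.
have cvg_a : x `^ s @[x --> a^'+] --> a `^ s.
  move: a0; rewrite le_eqVlt => /predU1P[<-|a0].
    by rewrite powR0 ?gt_eqF//; exact: powR_cvg0.
  by apply: cvg_at_right_filter; exact: continuous_powR.
apply: (cvgr_to_ge (cvgM cvg_a (cvg_cst b))).
by near=> c => /=; apply: m_le; near: c; exact: nbhs_right_gt.
Unshelve. all: by end_near. Qed.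

Lemma powR_left_le s a b m : 0 < a ->
  (forall c, 0 < c < a -> c `^ s * b <= m) -> a `^ s * b <= m.
Proof.
move=> a0 le_m.
have cvg_a : x `^ s @[x --> a^'-] --> a `^ s.
  by apply: cvg_at_left_filter; exact: continuous_powR.
apply: (cvgr_to_le (cvgM cvg_a (cvg_cst b))).
near=> c => /=; apply: le_m; apply/andP; split; near: c; last first.
  exact: nbhs_left_lt.
exact: nbhs_left_gt.
Unshelve. all: by end_near. Qed.

End powR_facts.

(** * Vectors supported on one coordinate, and truncations *)

Section lp_facts.
Context (R : realType) (k : scalar_kind) (p : R) (p_gt1 : 1 < p).
Context (X : nat -> normedModType (scalar_field R k)).
Local Notation K := (scalar_field R k).
Local Notation L := (lp_sum (ltW p_gt1) X).
Local Notation of_real := (@scalar_of_real R k).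
Local Notation re := (@scalar_re R k).
Implicit Types x y z : L.

Let p_gt0 : 0 < p. Proof. exact: lt_trans p_gt1. Qed.

Lemma rnorm_lp x : rnorm x = lp_norm x.
Proof. by rewrite /rnorm lp_sum_normE scalar_reK. Qed.

Lemma lp_norm_ge0 x : 0 <= lp_norm x.
Proof. exact: powR_ge0. Qed.

Lemma lp_norm_powR x :
  (\sum_(n <oo) (rnorm (x n) `^ p)%:E)%E = (lp_norm x `^ p)%:E.
Proof.
have S0 : (0 <= \sum_(n <oo) (rnorm (x n) `^ p)%:E)%E.
  by apply: nneseries_ge0 => n _ _; rewrite lee_fin powR_ge0.
rewrite /lp_norm -powRrM mulVf ?gt_eqF// powRr1 ?fine_ge0// fineK//.
by rewrite ge0_fin_numE//; exact: lp_seqP.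
Qed.

Lemma lp_norm_cvg x :
  series (fun n => rnorm (x n) `^ p) @ \oo --> lp_norm x `^ p.
Proof.
have : (\sum_(0 <= n < N) (rnorm (x n) `^ p)%:E)%E @[N --> \oo] -->
    (lp_norm x `^ p)%:E.
  rewrite -lp_norm_powR; apply: is_cvg_nneseries => n _ _.
  by rewrite lee_fin powR_ge0.
move/fine_cvgP => [_]; apply: cvg_trans; apply: near_eq_cvg; near=> N.
by rewrite /= sumEFin.
Unshelve. all: by end_near. Qed.

Lemma lp_summable_single n (v : X n) :
  lp_summable p (eqtype.dfwith (fun m => 0 : X m) v).
Proof.
rewrite /lp_summable (@nneseriesD1 _ _ n)//=; last first.
  by move=> m _; rewrite lee_fin powR_ge0.
rewrite eseries0 ?adde0 ?ltry// => m _ mn.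
by rewrite dfwith_out 1?eq_sym// rnorm0 powR0// gt_eqF.
Qed.

Definition lp_single n (v : X n) : L := LpSum _ (lp_summable_single v).

Lemma lp_single_in n (v : X n) : lp_single v n = v.
Proof. exact: dfwith_in. Qed.

Lemma lp_single_out n m (v : X n) : n != m -> lp_single v m = 0.
Proof. by move=> nm; exact: dfwith_out. Qed.

Lemma lp_single_linear n (v w : X n) (l : K) :
  lp_single (v + l *: w) = lp_single v + l *: lp_single w.
Proof.
apply: lp_sum_eq => m; rewrite lp_sumDE lp_sumZE.
have [nm|nm] := eqVneq n m; first by subst m; rewrite !lp_single_in.
by rewrite !lp_single_out// scaler0 addr0.
Qed.

(** Only the [n]-th term of the series of [p]-th powers changes; the rest [T] is finite and
    cancels. *)
Lemma lp_normD_single x n (v : X n) : lp_norm (x + lp_single v) `^ p =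
  lp_norm x `^ p + (rnorm (x n + v) `^ p - rnorm (x n) `^ p).
Proof.
pose T := (\sum_(m <oo | m != n) (rnorm (x m) `^ p)%:E)%E.
have split z : (forall m, m != n -> z m = x m) ->
    (lp_norm z `^ p)%:E = ((rnorm (z n) `^ p)%:E + T)%E.
  move=> zx; have z0 m : xpredT m -> (0 <= (rnorm (z m) `^ p)%:E)%E.
    by rewrite lee_fin powR_ge0.
  rewrite -[LHS]lp_norm_powR (nneseriesD1 z0 (isT : xpredT n)).
  by congr (_ + _)%E; apply: eq_eseriesr => m mn; rewrite zx.
have T_fin : T \is a fin_num.
  by have := split x (fun _ _ => erefl); case: (T).
have splitr z : (forall m, m != n -> z m = x m) ->
    lp_norm z `^ p = rnorm (z n) `^ p + fine T.
  by move=> /split; rewrite -[T]fineK// -EFinD => -[].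
have shift (a b c d t : R) : a = b + t -> c = d + t -> c = a + (d - b).
  by move=> -> ->; ring.
apply: shift (splitr x (fun _ _ => erefl)) _.
rewrite -{2}[v](lp_single_in v) -lp_sumDE; apply: splitr => m mn.
by rewrite lp_sumDE lp_single_out 1?eq_sym// addr0.
Qed.

Lemma lp_sum_single_seq (F : forall n, X n) N n :
  (\sum_(0 <= m < N) lp_single (F m)) n = if (n < N)%N then F n else 0.
Proof.
elim: N => [|N IH]; first by rewrite big_geq.
rewrite big_nat_recr// lp_sumDE IH ltnS; have [->|nN] := eqVneq n N.
  by rewrite ltnn leqnn add0r lp_single_in.
by rewrite lp_single_out 1?eq_sym// addr0 [(n <= N)%N]leq_eqVlt (negbTE nN).
Qed.

(** The [p]-th powers of the norms of the remainders are the tails of a convergent series. *)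
Lemma lp_single_cvg x :
  lp_norm (x - \sum_(0 <= m < N) lp_single (x m)) @[N --> \oo] --> (0 : R).
Proof.
pose r N := x - \sum_(0 <= m < N) lp_single (x m).
have rE N m : r N m = if (m < N)%N then 0 else x m.
  rewrite -[LHS]/(x m - (\sum_(0 <= i < N) lp_single (x i)) m).
  by rewrite lp_sum_single_seq; case: ifP; rewrite ?subrr ?subr0.
have tailE N : (\sum_(N <= m <oo) (rnorm (x m) `^ p)%:E)%E =
    (lp_norm (r N) `^ p)%:E.
  rewrite -lp_norm_powR eseries_cond eseries_mkcond; apply: eq_eseriesr => m _.
  by rewrite rE /=; case: ltnP => // _; rewrite rnorm0 powR0// gt_eqF.
have tail_cvg : (\sum_(N <= m <oo) (rnorm (x m) `^ p)%:E)%E @[N --> \oo] --> 0%E.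
  apply: nneseries_tail_cvg => [|n _]; first exact: lp_seqP.
  by rewrite lee_fin powR_ge0.
move: tail_cvg; under eq_fun do rewrite tailE.
move=> /fine_cvgP[_ /cvgr_lt r_cvg].
apply/cvgr0Pnorm_lt => e e0; near=> N.
rewrite ger0_norm ?lp_norm_ge0// ltNge; apply/negP => e_le.
have : lp_norm (r N) `^ p < e `^ p by near: N; apply: r_cvg; rewrite powR_gt0.
by rewrite ltNge ge0_ler_powR ?nnegrE ?(ltW p_gt0)// ?lp_norm_ge0// ltW.
Unshelve. all: by end_near. Qed.

End lp_facts.

(** * Restricting a norming functional to the coordinates *)

Section lp_duality.
Context (R : realType) (k : scalar_kind) (p : R) (p_gt1 : 1 < p).
Context (X : nat -> normedModType (scalar_field R k)).
Local Notation K := (scalar_field R k).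
Local Notation L := (lp_sum (ltW p_gt1) X).
Local Notation of_real := (@scalar_of_real R k).
Local Notation re := (@scalar_re R k).
Implicit Types x y z : L.

Let p_gt0 : 0 < p. Proof. exact: lt_trans p_gt1. Qed.

(** [F] is 1-Lipschitz, so it passes to the limit along the truncations of [z]. *)
Lemma lp_functional_series (F : L -> K) z : scalar_linear F ->
  (forall z, `|F z| <= `|z|) ->
  series (fun n => F (lp_single p_gt1 (z n))) @ \oo --> F z.
Proof.
move=> F_lin F_le; apply/cvgrPdist_lt => e e0.
(* A positive [e] in [K] is real, so its real part can serve as the tolerance in [R]. *)
have re_e : of_real (re e) = e by rewrite scalar_of_realK// ltW.
have re_e0 : 0 < re e.
  by rewrite -(ltr_scalar_of_real k) re_e scalar_of_real0.
near=> N.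
rewrite /series/= -(scalar_linear_sum _ _ F_lin) -(scalar_linearB _ _ F_lin).
apply: le_lt_trans (F_le _) _; rewrite lp_sum_normE -re_e.
rewrite ltr_scalar_of_real -[ltLHS]ger0_norm ?lp_norm_ge0//; near: N.
exact: cvgr0_norm_lt (lp_single_cvg z) _ re_e0.
Unshelve. all: by end_near. Qed.

(** The factor [|x|^(p-1)] is a normalization: when [F] norms [x], the restriction to [X n] is then
    bounded by [|x_n|^(p-1)]. *)
Definition lp_coordinate x (F : L -> K) n (v : X n) : K :=
  of_real (lp_norm x `^ (p - 1)) * F (lp_single p_gt1 v).

Section norming_functional.
Variables (x : L) (F : L -> K).
Hypotheses (F_lin : scalar_linear F) (F_le : forall z, `|F z| <= `|z|).
Hypothesis Fx : F x = `|x|.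

Let A := lp_norm x.
Let A_ge0 : 0 <= A := lp_norm_ge0 x.

Local Notation G := (lp_coordinate x F).

Let reF_le z : re (F z) <= lp_norm z.
Proof.
rewrite -rnorm_lp; apply: le_trans (ler_norm _) _.
apply: le_trans (ler_scalar_re_norm _) _.
by rewrite -(ler_scalar_of_real k) scalar_of_rnorm scalar_of_realK.
Qed.

Lemma coordinate_linear n : scalar_linear (@lp_coordinate x F n).
Proof.
by move=> v w l; rewrite /lp_coordinate lp_single_linear -F_lin mulrDr mulrCA.
Qed.

(** With [B = |x + v|], the bound on [F] gives [re (F v) <= B - A]. The tangent at [A] bounds
    [p A^(p-1) (B - A)] by [B^p - A^p]; this equals the change in the [n]-th term, which the tangent
    at [|x_n + v|] bounds in turn. *)
Lemma coordinate_re_le n (v : X n) : re (G v) <=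
  rnorm (x n + v) `^ (p - 1) * (rnorm (x n + v) - rnorm (x n)).
Proof.
set c := rnorm (x n + v); set B := lp_norm (x + lp_single p_gt1 v).
have FB : re (F (lp_single p_gt1 v)) <= B - A.
  have := reF_le (x + lp_single p_gt1 v).
  rewrite -{1}[lp_single p_gt1 v]scale1r -F_lin mul1r scalar_reD Fx.
  by rewrite lp_sum_normE scalar_reK -lerBrDl.
rewrite scalar_reZ -(ler_pM2l p_gt0).
apply: (@le_trans _ _ (p * (A `^ (p - 1) * (B - A)))).
  by rewrite (ler_pM2l p_gt0) ler_wpM2l ?powR_ge0.
have c_tangent := powR_tangent p_gt1 (rnorm_ge0 (x n)) (rnorm_ge0 (x n + v)).
apply: le_trans c_tangent.
have := powR_tangent p_gt1 (lp_norm_ge0 (x + lp_single p_gt1 v)) A_ge0.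
rewrite -lerN2 -!mulrN !opprB => /le_trans; apply; rewrite lerBlDl.
have := lexx (lp_norm (x + lp_single p_gt1 v) `^ p).
by rewrite {2}lp_normD_single.
Qed.

(** Apply [coordinate_re_le] to a small multiple [t v] of norm [c - |x_n|], divide by [t], and let
    [c] decrease to [|x_n|]. *)
Lemma coordinate_re_bound n (v : X n) :
  re (G v) <= rnorm (x n) `^ (p - 1) * rnorm v.
Proof.
have a0 := rnorm_ge0 (x n).
have p1 : 0 < p - 1 by rewrite subr_gt0.
have [v0|v_neq0] := eqVneq (rnorm v) 0.
  rewrite v0 mulr0 (rnorm0_eq0 v0) scalar_linear0 ?scalar_re0//.
  exact: coordinate_linear.
have v_gt0 : 0 < rnorm v by rewrite lt0r v_neq0 rnorm_ge0.
apply: powR_right_le => // c ac.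
have t0 : 0 < (c - rnorm (x n)) / rnorm v by rewrite divr_gt0// subr_gt0.
set t := _ / _ in t0.
have tv : rnorm (of_real t *: v) = c - rnorm (x n).
  by rewrite rnormZ scalar_norm_of_real ?(ltW t0)// scalar_reK divfK.
have := coordinate_re_le (of_real t *: v).
rewrite scalar_linearZ ?scalar_reZ; last exact: coordinate_linear.
have := ler_rnormD (x n) (of_real t *: v); rewrite tv.
set c' := rnorm (x n + _) => c'c G_le; rewrite -(ler_pM2l t0).
apply: le_trans G_le _; have c'0 : 0 <= c' := rnorm_ge0 _.
have tE : t * rnorm v = c - rnorm (x n) by rewrite divfK.
(* [c'] is replaced by [c] in the difference first: [c' - |x_n|] may be negative, whereas
   [c - |x_n|] is positive and allows enlarging the power. *)
rewrite mulrCA tE; apply: (@le_trans _ _ (c' `^ (p - 1) * (c - rnorm (x n)))).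
  by rewrite ler_wpM2l ?powR_ge0//; lra.
rewrite ler_wpM2r ?subr_ge0 ?(ltW ac)// ge0_ler_powR ?nnegrE ?(ltW p1)//; lra.
Qed.

Lemma coordinate_norm_le n (v : X n) :
  `|G v| <= of_real (rnorm (x n) `^ (p - 1)) * `|v|.
Proof.
by apply: scalar_norm_le (@coordinate_re_bound n); exact: coordinate_linear.
Qed.

(** One inequality is the norm bound. For the other, shrink [x_n] to norm [c < |x_n|] in
    [coordinate_re_le] and let [c] increase to [|x_n|]. *)
Lemma coordinate_self n : x n != 0 -> G (x n) = of_real (rnorm (x n) `^ p).
Proof.
move=> xn0; have a0 : 0 < rnorm (x n).
  by rewrite lt0r rnorm_ge0 andbT; apply: contra_neq xn0; exact: rnorm0_eq0.
have aE : rnorm (x n) `^ (p - 1) * rnorm (x n) = rnorm (x n) `^ p.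
  by rewrite mulrC mulr_powRB1// ltW.
suff reG : re (G (x n)) = rnorm (x n) `^ p.
  rewrite -reG; apply: scalar_norm_eq; rewrite reG -aE scalar_of_realM.
  by rewrite scalar_of_rnorm coordinate_norm_le.
apply/eqP; rewrite eq_le -{1}aE coordinate_re_bound/=.
rewrite -aE; apply: powR_left_le => // c /andP[c0 ca].
(* Chosen so that [(1 - t) x_n] has norm [c]. *)
pose t := (rnorm (x n) - c) / rnorm (x n).
have t0 : 0 < t by rewrite divr_gt0// subr_gt0.
have tE : t * rnorm (x n) = rnorm (x n) - c by rewrite divfK ?gt_eqF.
have := coordinate_re_le (of_real (- t) *: x n).
rewrite scalar_linearZ ?scalar_reZ; last exact: coordinate_linear.
have -> : x n + of_real (- t) *: x n = of_real (1 - t) *: x n.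
  by rewrite scalar_of_realD scalerDl scalar_of_real1 scale1r.
have ct : rnorm (of_real (1 - t) *: x n) = c.
  have -> : 1 - t = c / rnorm (x n) by rewrite /t; field; rewrite gt_eqF.
  rewrite rnormZ scalar_norm_of_real ?divr_ge0 ?ltW// scalar_reK divfK//.
  by rewrite gt_eqF.
rewrite ct => G_le; rewrite -(ler_pM2l t0) mulrCA tE; lra.
Qed.

End norming_functional.
End lp_duality.

(** * The two implications between orthogonality and the vanishing series *)

Section birkhoff_lp.
Context (R : realType) (k : scalar_kind) (p : R) (p_gt1 : 1 < p).
Context (X : nat -> normedModType (scalar_field R k)).
Local Notation K := (scalar_field R k).
Local Notation L := (lp_sum (ltW p_gt1) X).
Local Notation of_real := (@scalar_of_real R k).
Local Notation re := (@scalar_re R k).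
Implicit Types x y z : L.

Let p_gt0 : 0 < p. Proof. exact: lt_trans p_gt1. Qed.

Definition sip_term (s : forall n, X n -> X n -> K) x y n : K :=
  if x n == 0 then 0 else of_real (rnorm (x n) `^ (p - 2)) * s n (x n) (y n).

Let powRM2 a : 0 < a -> a `^ (p - 2) * (a * a) = a `^ p.
Proof.
by move=> a0; rewrite -expr2 -powR_mulrn ?ltW// powRD_gt0// subrK.
Qed.

Lemma scalar_re_cvg0 (u : nat -> K) :
  u @ \oo --> (0 : K) -> re (u N) @[N --> \oo] --> (0 : R).
Proof.
move=> u0; apply/cvgr0Pnorm_lt => e e0; near=> N.
apply: le_lt_trans (ler_scalar_re_norm _) _.
rewrite -(ltr_scalar_of_real k) scalar_of_realK//; near: N.
by apply: cvgr0_norm_lt u0 _ _; rewrite -(scalar_of_real0 R k) ltr_scalar_of_real.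
Unshelve. all: by end_near. Qed.

(** Here [q = |x_n|^(p-2)], [a = |x_n|], [c = |z_n|], [b = |z_n|^p], and [r] is the real part of [l
    [x_n, y_n]]; Cauchy-Schwarz multiplied by [p q] is chained with Young. *)
Let combine_young q r a c b : 0 < q -> a ^+ 2 + r <= a * c ->
  p * (q * a * c) <= (p - 1) * (q * (a * a)) + b ->
  p * (q * r) <= b - q * (a * a).
Proof.
move=> q0 /(ler_wpM2l (ltW (mulr_gt0 p_gt0 q0))); lra.
Qed.

Lemma birkhoff_sip_series x y : birkhoff_orthogonal x y ->
  exists2 s : forall n, X n -> X n -> K,
    (forall n, semi_inner_product (s n)) &
    series (sip_term s x y) @ \oo --> (0 : K).
Proof.
move=> xy.
have [F [F_lin F_le Fx Fy]] := birkhoff_functional xy.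
pose A := lp_norm x.
pose G n := @lp_coordinate _ _ _ p_gt1 X x F n.
(* The exponent [2 - p] cancels the weight [p - 2], so that each term of the series becomes
   [G n (y n)]. *)
pose P n (s : X n -> X n -> K) := semi_inner_product s /\
  (x n != 0 -> forall v, s (x n) v = of_real (rnorm (x n) `^ (2 - p)) * G n v).
have s_exists n : exists s, P n s.
  have [x0|xn0] := eqVneq (x n) 0.
    have [f f_sip] := sip_functional_exists (0 : X n).
    have [s s_sip _] := semi_inner_product_extend f_sip.
    by exists s; split; rewrite // x0 eqxx.
  have a0 : 0 < rnorm (x n).
    by rewrite lt0r rnorm_ge0 andbT; apply: contra_neq xn0; exact: rnorm0_eq0.
  have [|s s_sip s_x] := @semi_inner_product_extend _ _ _ (x n)
      (fun v => of_real (rnorm (x n) `^ (2 - p)) * G n v); last by exists s.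
  (* The exponents add up to [(2 - p) + (p - 1) = 1] in the norm bound and to [(2 - p) + p = 2] at
     [x n]. *)
  split=> [v w l|v|].
  - by rewrite /G -(coordinate_linear x F_lin) mulrDr [l * _]mulrCA.
  - rewrite normrM scalar_norm_of_real ?powR_ge0//.
    apply: le_trans (ler_wpM2l _ (coordinate_norm_le F_lin F_le Fx v)) _.
      by rewrite -(scalar_of_real0 R k) ler_scalar_of_real powR_ge0.
    rewrite mulrA -scalar_of_realM powRD_gt0//.
    rewrite (_ : 2 - p + (p - 1) = 1); last by ring.
    by rewrite powRr1 ?rnorm_ge0// scalar_of_rnorm.
  rewrite /G (coordinate_self F_lin F_le Fx xn0) -scalar_of_realM.
  rewrite powRD_gt0// subrK.
  by rewrite -scalar_of_rnorm -scalar_of_realX powR_mulrn ?rnorm_ge0.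
have [s sP] : exists s : forall n, X n -> X n -> K, forall n, P n (s n).
  by exists (fun n => sval (cid (s_exists n))) => n; exact: svalP.
exists s => [n|]; first by have [] := sP n.
have -> : sip_term s x y = (fun n => G n (y n)).
  (* Where [x n = 0], the bound [0^(p-1) = 0] makes [G n] vanish, in accordance with the convention
     for such terms. *)
  apply/funext => n; rewrite /sip_term; case: eqVneq => [x0|xn0].
    apply/esym/eqP; rewrite -normr_le0.
    apply: le_trans (coordinate_norm_le F_lin F_le Fx (y n)) _.
    by rewrite x0 rnorm0 powR0 ?scalar_of_real0 ?mul0r// gt_eqF// subr_gt0.
  have [_ ->//] := sP n.
  rewrite mulrA -scalar_of_realM powRD_gt0; last first.
    by rewrite lt0r rnorm_ge0 andbT; apply: contra_neq xn0; exact: rnorm0_eq0.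
  by rewrite -[2 - p]opprB subrr powRr0 scalar_of_real1 mul1r.
have := @lp_functional_series _ _ _ p_gt1 X F y F_lin F_le; rewrite Fy => F_cvg.
have -> : series (fun n => G n (y n)) = (fun N => of_real (A `^ (p - 1)) *
    series (fun n => F (lp_single p_gt1 (y n))) N).
  by apply/funext => N; rewrite /series/= mulr_sumr.
have := cvgM (cvg_cst (of_real (A `^ (p - 1)))) F_cvg; rewrite mulr0; exact.
Qed.

Lemma sip_series_birkhoff s x y : (forall n, semi_inner_product (s n)) ->
  series (sip_term s x y) @ \oo --> (0 : K) -> birkhoff_orthogonal x y.
Proof.
move=> s_sip T_cvg l; rewrite !lp_sum_normE ler_scalar_of_real.
set z := x + l *: y.
have term_le n :
    p * re (l * sip_term s x y n) <= rnorm (z n) `^ p - rnorm (x n) `^ p.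
  rewrite /sip_term; case: eqVneq => [->|xn0].
    by rewrite mulr0 scalar_re0 mulr0 rnorm0 powR0 ?gt_eqF// subr0 powR_ge0.
  have [sE s_lin _ s_le] := s_sip n.
  have a0 : 0 < rnorm (x n).
    by rewrite lt0r rnorm_ge0 andbT; apply: contra_neq xn0; exact: rnorm0_eq0.
  have re_s : re (s n (x n) (z n)) <= rnorm (x n) * rnorm (z n).
    apply: le_trans (ler_norm _) _; apply: le_trans (ler_scalar_re_norm _) _.
    rewrite -(ler_scalar_of_real k) scalar_of_realK// scalar_of_realM.
    rewrite !scalar_of_rnorm -(@ler_pXn2r _ 2)// ?nnegrE ?mulr_ge0//.
    by rewrite exprMn -!sE.
  have zE : s n (x n) (z n) = of_real (rnorm (x n) ^+ 2) + l * s n (x n) (y n).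
    by rewrite -[z n]/(x n + l *: y n) -s_lin sE scalar_of_realX scalar_of_rnorm.
  have := young_powR p_gt1 (rnorm_ge0 (x n)) (rnorm_ge0 (z n)).
  move: re_s; rewrite zE scalar_reD scalar_reK [l * (_ * _)]mulrCA scalar_reZ.
  have <- : rnorm (x n) `^ (p - 2) * rnorm (x n) = rnorm (x n) `^ (p - 1).
    rewrite -[X in _ * X](powRr1 (rnorm_ge0 (x n))) powRD_gt0//.
    by congr (_ `^ _); ring.
  rewrite -(powRM2 a0); exact/combine_young/powR_gt0.
(* Partial sums are compared, since the series of terms is only known to converge as a limit of
   these; its contribution then tends to 0. *)
have sum_le N : series (fun n => rnorm (x n) `^ p) N +
    p * re (l * series (sip_term s x y) N) <=
    series (fun n => rnorm (z n) `^ p) N.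
  rewrite /series/= -lerBrDl mulr_sumr scalar_re_sum mulr_sumr -sumrB.
  by apply: ler_sum => n _; exact: term_le.
have re_cvg : p * re (l * series (sip_term s x y) N) @[N --> \oo] --> (0 : R).
  have lT_cvg : l * series (sip_term s x y) N @[N --> \oo] --> (0 : K).
    by have := cvgM (cvg_cst l) T_cvg; rewrite mulr0; exact.
  by have := cvgM (cvg_cst p) (scalar_re_cvg0 lT_cvg); rewrite mulr0; exact.
have pow_le : lp_norm x `^ p <= lp_norm z `^ p.
  have norm_cvg := @lp_norm_cvg _ _ _ p_gt1 X.
  rewrite -[leLHS]addr0.
  exact: (ler_cvg_to (cvgD (norm_cvg x) re_cvg) (norm_cvg z) (nearW _ sum_le)).
have nneg (w : L) : lp_norm w \in Num.nneg by rewrite nnegrE lp_norm_ge0.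
rewrite leNgt; apply/negP => /(gt0_ltr_powR p_gt0 (nneg z) (nneg x)).
by apply/negP; rewrite -leNgt.
Qed.

End birkhoff_lp.

Theorem corollary20 (R : realType) (k : scalar_kind)
    (X : nat -> normedModType (scalar_field R k))
    (X_nontrivial : forall n, exists v : X n, v != 0)
    (p : R) (p_gt1 : 1 < p) (x y : lp_sum (ltW p_gt1) X) :
  birkhoff_orthogonal x y <->
  exists2 s : forall n, X n -> X n -> scalar_field R k,
    (forall n, semi_inner_product (s n)) &
    series (fun n => if x n == 0 then 0
                     else scalar_of_real k (rnorm (x n) `^ (p - 2))
                          * s n (x n) (y n)) @ \oo --> (0 : scalar_field R k).
Proof.
split; first exact: birkhoff_sip_series.
by case=> s s_sip; exact: sip_series_birkhoff.
Qed.
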